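(* There is an absolute constant $C>0$ such that the following holds. Fix any $\epsilon>0$ and any $\ell_p$ norm with $p\in(1,\infty]$. For any $\delta>0$, there exist $d,K\in\mathbb{N}$ and a finitely supported distribution $\mu\in\mathcal{P}(\mathbb{R}^d\times[K])$ with support $s_\mu$ such that $$\mathrm{rg}(\mu,\epsilon)\ge\tfrac12-\delta,$$ the conflict graph $G_{s_\mu}^\epsilon$ is not perfect, the conflict hypergraph $H_{s_\mu}^\epsilon$ is conformal, and the number of classes satisfies $K\le C\sqrt{n/\log n}$, where $n=|s_\mu|$ (i.e., $K\in\mathcal{O}(\sqrt{n/\log n})$).
   Context: Here the input space is $\mathcal{X}=\mathbb{R}^d$ and the label space is $\mathcal{Y}=[K]=\{1,\dots,K\}$. Notation: $B_p(x,\epsilon)=\{x'\in\mathcal{X}:\|x'-x\|_p\le\epsilon\}$. $\mathcal{P}(\mathcal{Z})$ is the set of probability distributions with finite support on $\mathcal{Z}$; $s_\mu$ denotes the support of $\mu$. Risks and randomization gap: $\mathcal{F}_{\mathrm{det}}$ is the set of all functions $f:\mathcal{X}\to\mathcal{Y}$ and $\mathcal{F}_{\mathrm{rand}}$ the set of all functions $f:\mathcal{X}\to\mathcal{P}(\mathcal{Y})$. For $\mu\in\mathcal{P}(\mathcal{X}\times\mathcal{Y})$, $$\mathcal{R}^*_{\mathcal{F}_{\mathrm{det}}}(\mu,\epsilon)=\inf_{f\in\mathcal{F}_{\mathrm{det}}}\mathbb{E}_{(x,y)\sim\mu}\Big[\sup_{x'\in B_p(x,\epsilon)}\mathbf{1}\{f(x')\neq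 y\}\Big],$$ $$\mathcal{R}^*_{\mathcal{F}_{\mathrm{rand}}}(\mu,\epsilon)=\inf_{f\in\mathcal{F}_{\mathrm{rand}}}\mathbb{E}_{(x,y)\sim\mu}\Big[\sup_{x'\in B_p(x,\epsilon)}\mathbb{E}_{z\sim f(x')}[\mathbf{1}\{z\neq y\}]\Big],$$ and $\mathrm{rg}(\mu,\epsilon)=\mathcal{R}^*_{\mathcal{F}_{\mathrm{det}}}(\mu,\epsilon)-\mathcal{R}^*_{\mathcal{F}_{\mathrm{rand}}}(\mu,\epsilon)$. Conflict hypergraph and graph: for $s_\mu=\{(x_i,y_i)\}_{i\in[n]}$, the conflict hypergraph $H_{s_\mu}^\epsilon$ has vertex set $[n]$, and a nonempty $e\subseteq[n]$ is a hyperedge iff (1) $y_i\neq y_j$ for all distinct $i,j\in e$, and (2) $\bigcap_{i\in e}B_p(x_i,\epsilon)\neq\emptyset$. The conflict graph $G_{s_\mu}^\epsilon$ is the simple graph on $[n]$ whose edges are the hyperedges of $H_{s_\mu}^\epsilon$ of size exactly $2$. The hypergraph $H_{s_\mu}^\epsilon$ is conformal if every clique (nonempty set of pairwise adjacent vertices) of $G_{s_\mu}^\epsilon$ is a hyperedge of $H_{s_\mu}^\epsilon$. A hole is an induced subgraph that is a cycle on more than three vertices; an anti-hole is an induced subgraph whose complement is a hole in the complement graph; ''odd'' refers to the number of vertices. A graph is perfect if it contains neither an odd hole nor an odd anti-hole. *)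

(* Defs.v *)
From HB Require Import structures.
From mathcomp Require Import all_boot all_order all_algebra finmap.
From mathcomp Require Import all_classical all_reals all_analysis.
Set Implicit Arguments.
Unset Strict Implicit.
Unset Printing Implicit Defensive.
Import Order.TTheory GRing.Theory Num.Theory.
Local Open Scope classical_set_scope.
Local Open Scope ring_scope.

Section Distributions.
Variables (R : realType) (T : choiceType).

(* The support is [finsupp mu], on which [mu] is nonzero by construction. *)
Record fsdist := FSDist {
  fsdist_fun :> {fsfun T -> R with 0};
  fsdist_ge0 : forall z, 0 <= fsdist_fun z;
  fsdist_sum1 : \sum_(z <- finsupp fsdist_fun) fsdist_fun z = 1 }.

Definition Esp (mu : fsdist) (F : T -> R) : R :=
  \sum_(z <- finsupp mu) mu z * F z.

End Distributions.

Section Norms.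
Variables (R : realType) (d : nat).

(* Only used for 1 < p; the value at -oo is a dummy. *)
Definition lpnorm (p : \bar R) (x : 'rV[R]_d) : R :=
  match p with
  | r%:E%E => (\sum_(i < d) `|x 0 i| `^ r) `^ r^-1
  | +oo%E => \big[Num.max/0]_(i < d) `|x 0 i|
  | -oo%E => 0
  end.

Definition lpball (p : \bar R) (x : 'rV[R]_d) (eps : R) : set 'rV[R]_d :=
  [set x' | lpnorm p (x' - x) <= eps].

End Norms.

(* The labels 1, ..., K are represented by 'I_K.  In the risks, the suprema
   are taken over nonempty subsets of [0, 1] when 0 <= eps, and the infima
   over subsets of [0, +oo[ that are nonempty when 0 < K, which the existence
   of mu forces; hence none of them takes the default value 0 of [sup]/[inf]
   on sets without a supremum/infimum. *)
Section Risks.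
Variables (R : realType) (d K : nat) (p : \bar R).
Local Notation X := 'rV[R]_d.
Local Notation Y := 'I_K.

Definition risk_det (mu : fsdist R (X * Y)%type) (eps : R) (f : X -> Y) : R :=
  Esp mu (fun z => sup [set (f x' != z.2)%:R | x' in lpball p z.1 eps]).

Definition risk_rand (mu : fsdist R (X * Y)%type) (eps : R)
    (f : X -> fsdist R Y) : R :=
  Esp mu (fun z => sup [set Esp (f x') (fun y => (y != z.2)%:R)
                        | x' in lpball p z.1 eps]).

Definition opt_risk_det (mu : fsdist R (X * Y)%type) (eps : R) : R :=
  inf [set risk_det mu eps f | f in [set: X -> Y]].

Definition opt_risk_rand (mu : fsdist R (X * Y)%type) (eps : R) : R :=
  inf [set risk_rand mu eps f | f in [set: X -> fsdist R Y]].

Definition rg (mu : fsdist R (X * Y)%type) (eps : R) : R :=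
  opt_risk_det mu eps - opt_risk_rand mu eps.

End Risks.

Section Conflicts.
Variables (R : realType) (d K : nat) (p : \bar R) (eps : R).
Variables (n : nat) (s : n.-tuple ('rV[R]_d * 'I_K)%type).

Definition conflict_hypergraph : {set {set 'I_n}} :=
  [set e : {set 'I_n} |
    [&& e != finset.set0,
        [forall i in e, forall j in e,
          (i != j) ==> ((tnth s i).2 != (tnth s j).2)] &
        `[< (\bigcap_(i in [set` e]) lpball p (tnth s i).1 eps !=set0)%classic >]]]%SET.

Definition conflict_graph : rel 'I_n :=
  fun i j => ([set i; j]%SET \in conflict_hypergraph)
             && (#|[set i; j]%SET| == 2%N).

End Conflicts.

(* Simple graphs are given by their (symmetric, irreflexive) adjacency
   relation. *)
Section Graphs.
Variable V : finType.
Implicit Types (e : rel V) (A : {set V}).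

Definition is_clique e A : Prop :=
  A != finset.set0 /\
  (forall i j, i \in A -> j \in A -> i != j -> e i j).

Definition conformal (H : {set {set V}}) e : Prop :=
  forall A, is_clique e A -> A \in H.

Definition compl_graph e : rel V := fun x y => (x != y) && ~~ e x y.

(* [c] lists the vertices of [A] in cyclic order. *)
Definition induces_cycle e A : Prop :=
  exists c : seq V,
    [/\ uniq c, A =i c &
        forall x y, x \in A -> y \in A ->
          e x y = (y == next c x) || (x == next c y)].

Definition is_hole e A : Prop := (3 < #|A|)%N /\ induces_cycle e A.

Definition is_antihole e A : Prop := is_hole (compl_graph e) A.

Definition perfect e : Prop :=
  ~ (exists A, odd #|A| /\ is_hole e A) /\
  ~ (exists A, odd #|A| /\ is_antihole e A).

End Graphs.

Definition support_tuple (R : realType) (T : choiceType) (mu : fsdist R T) :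
  #|` finsupp mu|.-tuple T := in_tuple (finsupp mu).

(* Main.v *)
Require Import Defs.
From mathcomp Require Import all_boot all_order all_algebra finmap.
From mathcomp Require Import all_classical all_reals all_analysis.
From mathcomp Require Import lra ring.
Import Order.TTheory GRing.Theory Num.Theory.
Local Open Scope ring_scope.

Set Implicit Arguments.
Unset Strict Implicit.
Unset Printing Implicit Defensive.

(* In a triangle-free conflict graph at most two labels compete at any point, so
   predicting them uniformly has risk at most 1/2; a deterministic classifier is
   robustly correct on an independent set only, so its risk is at least
   1 - delta if independent sets have weight at most delta.  Iterated
   Mycielskians of an edge are triangle-free and carry such weights, since
   their fractional chromatic numbers follow f |-> f + 1/f.  Every finite graph
   is the intersection graph of equal l_p balls when 1 < p, because
   2^p > 1^p + 1^p.  Finally, taking many disjoint copies of the graph changes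
   neither the bound on independent sets nor the number of labels, which makes
   the bound on K free. *)

(** * Fractional chromatic number of Mycielskians *)

Definition indep (V : finType) (e : rel V) (I : pred V) : Prop :=
  forall x y, I x -> I y -> ~~ e x y.

Definition triangle_free (V : finType) (e : rel V) : Prop :=
  forall x y z, e x y -> e y z -> ~~ e x z.

Definition has_odd_hole (V : finType) (e : rel V) : Prop :=
  exists A : {set V}, odd #|A| /\ is_hole e A.

Lemma has_odd_hole_embed (V V' : finType) (e : rel V) (e' : rel V')
    (h : V -> V') :
  injective h -> (forall x y, e' (h x) (h y) = e x y) ->
  has_odd_hole e -> has_odd_hole e'.
Proof.
move=> hI eh [A [oA [A3 [c [uc Ac ce]]]]].
exists (h @: A)%SET; rewrite /is_hole card_imset//; split=> //; split=> //.
exists (map h c); split.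
- by rewrite map_inj_uniq.
- move=> y; apply/imsetP/mapP => -[x xA ->]; exists x => //.
  + by rewrite -Ac.
  + by rewrite Ac.
- move=> _ _ /imsetP[x xA ->] /imsetP[y yA ->].
  by rewrite eh !(next_map hI) ?(inj_eq hI) ?ce.
Qed.

(** [inl v] is the original vertex, [inr v] its shadow, [None] the apex. *)
Definition mycielskian (V : finType) (e : rel V) : rel (option (V + V)) :=
  fun x y => match x, y with
  | Some (inl v), Some (inl w)
  | Some (inl v), Some (inr w)
  | Some (inr v), Some (inl w) => e v w
  | Some (inr _), None | None, Some (inr _) => true
  | _, _ => false
  end.

Section Mycielski.
Variables (V : finType) (e : rel V).
Hypotheses (esym : symmetric e) (eirr : irreflexive e).

Lemma mycielskian_sym : symmetric (mycielskian e).
Proof. by move=> [[x|x]|] [[y|y]|] //=; rewrite esym. Qed.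

Lemma mycielskian_irr : irreflexive (mycielskian e).
Proof. by move=> [[x|x]|] //=; rewrite eirr. Qed.

(** Shadows are pairwise non-adjacent and the apex sees only shadows, so a triangle would project to
    a triangle of [e]. *)
Lemma mycielskian_triangle_free :
  triangle_free e -> triangle_free (mycielskian e).
Proof.
by move=> etf [[x|x]|] [[y|y]|] [[z|z]|] //=; exact: etf.
Qed.

End Mycielski.

Lemma big_option_sum (R : nmodType) (V : finType) (P : pred (option (V + V)))
    (F : option (V + V) -> R) :
  \sum_(x | P x) F x = (if P None then F None else 0)
    + (\sum_(v | P (Some (inl v))) F (Some (inl v))
       + \sum_(v | P (Some (inr v))) F (Some (inr v))).
Proof.
rewrite big_mkcond/= (bigD1 None)//=; congr (_ + _).
rewrite (reindex_omap Some id) => [|[x|]]//=.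
under eq_bigl => x do rewrite eqxx.
by rewrite big_sumType/= -!big_mkcond.
Qed.

(* By linear programming duality this says that the fractional chromatic number
   of [e] is at most [f]. *)
Definition frac_chrom_le (R : realFieldType) (V : finType) (e : rel V) (f : R) :=
  forall u : V -> R, (forall v, 0 <= u v) ->
  exists2 I : pred V, indep e I & \sum_v u v <= f * \sum_(v | I v) u v.

(** The dual certificate: such a [w] bounds the fractional chromatic number below by [f]. Strict
    positivity later puts every vertex in the support. *)
Definition frac_clique (R : realFieldType) (V : finType) (e : rel V) (w : V -> R)
    (f : R) :=
  [/\ forall v, 0 < w v, \sum_v w v = f &
      forall I : pred V, indep e I -> \sum_(v | I v) w v <= 1].

Section FractionalMycielski.
Variables (R : realFieldType) (V : finType) (e : rel V) (f : R).
Hypotheses (esym : symmetric e) (f1 : 1 < f).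

(** One of three independent sets is heavy enough: [I] together with its shadows, with [I] good for
    [u1 + u2]; the apex with a set [J] good for [u1]; or all shadows. *)
Lemma mycielskian_frac_chrom :
  frac_chrom_le e f -> frac_chrom_le (mycielskian e) (f + f^-1).
Proof.
move=> ef u u0.
pose u1 v := u (Some (inl v)); pose u2 v := u (Some (inr v)).
pose s1 := \sum_v u1 v; pose s2 := \sum_v u2 v; pose z := u None.
have [I Ii lI] := ef (fun v => u1 v + u2 v) (fun v => addr_ge0 (u0 _) (u0 _)).
have [J Ji lJ] := ef u1 (fun v => u0 _).
rewrite !big_split/= -/s1 -/s2 in lI.
rewrite -/s1 in lJ.
have f0 : 0 < f := lt_trans ltr01 f1.
have sumE : \sum_v u v = z + (s1 + s2) by rewrite big_option_sum.
set t1 := \sum_(v | I v) u1 v in lI; set t2 := \sum_(v | I v) u2 v in lI.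
set t3 := \sum_(v | J v) u1 v in lJ.
have [fV0 ffV] : 0 < f^-1 /\ f * f^-1 = 1.
  by rewrite invr_gt0 mulfV ?gt_eqF.
set g := f^-1 in fV0 ffV *.
pose total := z + (s1 + s2).
have [h1|h1] := leP total ((f + g) * (t1 + t2)).
  exists (fun x => match x with
    Some (inl v) | Some (inr v) => I v | _ => false end).
    by move=> [[x|x]|] [[y|y]|] //=; exact: Ii.
  by rewrite sumE big_option_sum/= add0r.
have [h2|h2] := leP total ((f + g) * (z + t3)).
  exists (fun x => match x with
    Some (inl v) => J v | Some (inr v) => false | _ => true end).
    by move=> [[x|x]|] [[y|y]|] //=; exact: Ji.
  by rewrite sumE big_option_sum/= big_pred0_eq addr0.
have [h3|h3] := leP total ((f + g) * s2).
  exists (fun x => match x with Some (inr v) => true | _ => false end).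
    by move=> [[x|x]|] [[y|y]|].
  by rewrite sumE big_option_sum/= big_pred0_eq !add0r.
(* The three weights, averaged with coefficients f - 1, 1 and 1/f, give at
   least the total weight. *)
exfalso.
have k1 : g * (s1 + s2) <= t1 + t2.
  by rewrite /g mulrC ler_pdivrMr// mulrC.
have k2 : g * s1 <= t3.
  by rewrite /g mulrC ler_pdivrMr// mulrC.
have {}h1 : (f - 1) * total > (f - 1) * ((f + g) * (t1 + t2)).
  by rewrite ltr_pM2l// subr_gt0.
have {}h3 : g * total > g * ((f + g) * s2) by rewrite ltr_pM2l.
have {}k1 : (f - 1) * ((f + g) * (g * (s1 + s2))) <= (f - 1) * ((f + g) * (t1 + t2)).
  by rewrite ler_pM2l ?subr_gt0// ler_pM2l// addr_gt0.
have {}k2 : (f + g) * (z + g * s1) <= (f + g) * (z + t3).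
  by rewrite ler_pM2l ?addr_gt0// lerD2l.
have : (f + g) * total = (f - 1) * ((f + g) * (g * (s1 + s2)))
   + (f + g) * (z + g * s1) + g * ((f + g) * s2).
  have -> : (f - 1) * ((f + g) * (g * (s1 + s2)))
    = (f * g - g) * ((f + g) * (s1 + s2)) by ring.
  by rewrite ffV /total; ring.
have -> : (f + g) * total = (f - 1) * total + total + g * total by ring.
by move=> E; lra.
Qed.

(** When [w] has total [f], the three kinds of vertices get total weights [f - 1], [1] and
    [f^-1]. *)
Definition mycielskian_weight (w : V -> R) (x : option (V + V)) : R :=
  match x with
  | Some (inl v) => (1 - f^-1) * w v
  | Some (inr v) => f^-1 * w v
  | None => f^-1
  end.

(** With the apex, [I] has no shadow and weighs at most [(1 - f^-1) + f^-1]. Without it, the scaled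
    weight of the shadows whose original lies outside [I] is at most that of an independent subset
    of these originals, which can be added to the originals in [I]. This exchange uses the upper
    bound [frac_chrom_le], hence both bounds are carried through the induction. *)
Lemma mycielskian_frac_clique (w : V -> R) :
  frac_chrom_le e f -> frac_clique e w f ->
  frac_clique (mycielskian e) (mycielskian_weight w) (f + f^-1).
Proof.
move=> ef [w0 wf wI].
have f0 : 0 < f := lt_trans ltr01 f1.
have fV0 : 0 < f^-1 by rewrite invr_gt0.
have fV1 : f^-1 < 1 by rewrite invf_lt1.
split.
- by move=> [[v|v]|] //=; rewrite mulr_gt0// subr_gt0.
- rewrite big_option_sum/= -!mulr_sumr wf mulrBl mul1r mulVf ?gt_eqF//.
  by rewrite subrK addrC.
move=> I Ii; rewrite big_option_sum/= -!mulr_sumr.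
pose I1 := [pred v | I (Some (inl v))]; pose I2 := [pred v | I (Some (inr v))].
have I1i : indep e I1 by move=> x y Ix Iy; exact: (Ii (Some (inl x)) (Some (inl y))).
have wI1 := wI _ I1i.
case: ifP => IN.
  rewrite [X in _ + (_ + _ * X)]big_pred0 ?mulr0 ?addr0; last first.
    by move=> v; apply/negP => Iv; have := Ii _ _ IN Iv.
  have : (1 - f^-1) * \sum_(v | I1 v) w v <= (1 - f^-1) * 1.
    by rewrite ler_pM2l// subr_gt0.
  by rewrite /I1/= => ?; lra.
rewrite add0r.
pose M := [pred v | I2 v && ~~ I1 v].
have wM v : 0 <= (if M v then w v else 0) by case: ifP => // _; exact: ltW.
have [J Ji lJ] := ef _ wM.
have MI1 x y : M x -> I1 y -> ~~ e x y.
  by move=> /andP[Ix _] Iy; exact: (Ii (Some (inr x)) (Some (inl y))).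
(* A shadow has the same original neighbours as its original, so no vertex of [M] is adjacent to one
   of [I1]. *)
have /wI : indep e [pred v | I1 v || (M v && J v)].
  move=> x y /= /orP[Ix|/andP[Mx Jx]] /orP[Iy|/andP[My Jy]].
  - exact: I1i.
  - by rewrite esym; exact: MI1.
  - exact: MI1.
  - exact: Ji.
rewrite (bigID I1)/=.
rewrite [X in X + _](eq_bigl I1); last first.
  by move=> v /=; case: (I (Some (inl v))); rewrite ?andbF.
rewrite [X in _ + X](eq_bigl [pred v | J v && M v]); last first.
  by move=> v /=; case: (I (Some (inl v))); rewrite ?andbF//= !andbT andbC.
rewrite -!big_mkcondr/= in lJ.
have : \sum_(v | I2 v) w v <= \sum_(v | I1 v) w v + \sum_(v | M v) w v.
  rewrite (bigID I1)/= lerD2r [leRHS]big_mkcond/= big_mkcond/= ler_sum// => v _.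
  by case: (I (Some (inr v))) => //=; case: ifP => // _; exact: ltW.
rewrite -(ler_pM2l fV0) => l2.
rewrite -(ler_pM2l fV0) mulrA mulVf ?gt_eqF// mul1r in lJ.
move: l2 lJ; rewrite /I1 /I2 /M /=; rewrite !mulrDr !mulrDl !mul1r.
by move=> *; lra.
Qed.

End FractionalMycielski.

Definition edge_graph : rel bool := fun x y => x != y.

(* The Mycielskian of a single edge is the 5-cycle. *)
Lemma mycielskian_edge_odd_hole : has_odd_hole (mycielskian edge_graph).
Proof.
pose c : seq (option (bool + bool)) :=
  [:: Some (inl true); Some (inl false); Some (inr true); None; Some (inr false)].
have mem_c x : x \in c by case: x => [[[]|[]]|].
have card5 : #|[set: option (bool + bool)]%SET| = 5%N.
  by rewrite cardsT card_option card_sum card_bool.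
exists [set: option (bool + bool)]%SET.
rewrite /is_hole card5; split=> //; split=> //; exists c; split=> //.
- by move=> x; rewrite mem_c finset.in_setT.
- by move=> [[[]|[]]|] [[[]|[]]|].
Qed.

Lemma mycielskian_odd_hole (V : finType) (e : rel V) :
  has_odd_hole e -> has_odd_hole (mycielskian e).
Proof. by apply: (@has_odd_hole_embed _ _ _ _ (Some \o inl)) => // x y []. Qed.

Lemma edge_frac_chrom (R : realFieldType) : frac_chrom_le edge_graph (2 : R).
Proof.
move=> u u0.
have ltE (c : bool) : \sum_(v | v == c) u v = u c by rewrite big_pred1_eq.
have [h|h] := leP (u true) (u false).
  exists (pred1 false) => [x y /eqP-> /eqP->//|].
  by rewrite ltE big_bool/=; lra.
exists (pred1 true) => [x y /eqP-> /eqP->//|].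
by rewrite ltE big_bool/=; lra.
Qed.

Lemma edge_frac_clique (R : realFieldType) :
  frac_clique edge_graph (fun=> 1 : R) 2.
Proof.
split=> // [|I Ii]; first by rewrite big_bool.
rewrite big_mkcond big_bool/=.
by case It: (I true); case If: (I false); rewrite ?addr0 ?add0r//;
  have := Ii _ _ It If.
Qed.

(** Since [(f + f^-1) ^+ 2 = f ^+ 2 + 2 + f^-1 ^+ 2], each Mycielskian raises [f ^+ 2] by more than
    1. The induction starts at the 5-cycle so that an odd hole is present from the outset. *)
Lemma triangle_free_large_frac_clique (R : realFieldType) (k : nat) :
  exists (V : finType) (e : rel V) (w : V -> R) (f : R),
    [/\ symmetric e, irreflexive e, triangle_free e, has_odd_hole e &
     [/\ 1 < f, k%:R <= f ^+ 2, frac_chrom_le e f & frac_clique e w f]].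
Proof.
have gt1 (f : R) : 1 < f -> 1 < f + f^-1.
  by move=> f1; rewrite (lt_trans f1)// ltrDl invr_gt0 (lt_trans ltr01 f1).
have step (V : finType) (e : rel V) (w : V -> R) (f : R) :
    symmetric e -> 1 < f -> frac_chrom_le e f -> frac_clique e w f ->
    [/\ 1 < f + f^-1, frac_chrom_le (mycielskian e) (f + f^-1) &
        frac_clique (mycielskian e) (mycielskian_weight f w) (f + f^-1)].
  move=> es f1 ef ew; split; first exact: gt1.
    exact: mycielskian_frac_chrom.
  exact: mycielskian_frac_clique.
have sym2 : symmetric edge_graph by move=> x y; rewrite /edge_graph eq_sym.
have irr2 : irreflexive edge_graph by move=> x; rewrite /edge_graph eqxx.
elim: k => [|k [V [e [w [f [es ei et eh [f1 fk ef ew]]]]]]].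
  have [] := step _ edge_graph (fun=> 1) 2 sym2 _
    (@edge_frac_chrom R) (@edge_frac_clique R); first by lra.
  move=> m1 mf mw; exists (option (bool + bool)), (mycielskian edge_graph).
  exists (mycielskian_weight 2 (fun=> 1)), (2 + 2^-1); split.
  - exact: mycielskian_sym.
  - exact: mycielskian_irr.
  - by apply: mycielskian_triangle_free; do 3![case].
  - exact: mycielskian_edge_odd_hole.
  - by split=> //; rewrite sqr_ge0.
have [m1 mf mw] := step _ _ _ _ es f1 ef ew.
exists (option (V + V)), (mycielskian e), (mycielskian_weight f w), (f + f^-1).
split.
- exact: mycielskian_sym.
- exact: mycielskian_irr.
- exact: mycielskian_triangle_free.
- exact: mycielskian_odd_hole.
- split=> //.
  have f0 : f != 0 by rewrite gt_eqF// (lt_trans ltr01 f1).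
  have : f * f^-1 = 1 by rewrite mulfV.
  have : 0 <= f^-1 ^+ 2 by rewrite sqr_ge0.
  rewrite -natr1 sqrrD => ? ->; lra.
Qed.

(** * Disjoint copies of a graph and the count of labels *)

Section Copies.
Variables (V : finType) (e : rel V) (m : nat).

Definition copies : rel (V * 'I_m.+1) :=
  fun x y => (x.2 == y.2) && e x.1 y.1.

Lemma copies_sym : symmetric e -> symmetric copies.
Proof. by move=> es x y; rewrite /copies es eq_sym. Qed.

Lemma copies_triangle_free : triangle_free e -> triangle_free copies.
Proof.
move=> et x y z /andP[/eqP xy exy] /andP[/eqP yz eyz].
by rewrite negb_and (et _ _ _ exy eyz) orbT.
Qed.

Lemma copies_odd_hole : has_odd_hole e -> has_odd_hole copies.
Proof.
apply: (@has_odd_hole_embed _ _ _ _ (fun v => (v, ord0))) => [x y []//|x y].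
by rewrite /copies eqxx.
Qed.

(** The weight of a set is the average of the weights of its slices, so a bound on the independent
    sets of one copy carries over to all copies. *)
Lemma copies_weight (R : realFieldType) (w : V -> R) (P : pred (V * 'I_m.+1)) :
  \sum_(x | P x) w x.1 / m.+1%:R =
  (\sum_(i < m.+1) \sum_(v | P (v, i)) w v) / m.+1%:R.
Proof.
rewrite -mulr_suml; congr (_ / _); rewrite (exchange_big_dep predT)//=.
by rewrite pair_big_dep/=; apply: eq_big => // -[].
Qed.

End Copies.

(** Each vertex of the base graph is its own label, reused in every copy. Dividing the fractional
    clique by [f] makes it a probability and bounds independent sets by [f^-1]. *)
Lemma sparse_colored_graph (R : realType) (delta : R) : 0 < delta ->
  exists (V : finType) (e : rel V) (w : V -> R) (K : nat) (y : V -> 'I_K),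
  [/\ symmetric e, triangle_free e, has_odd_hole e,
      forall i j, e i j -> y i != y j &
  [/\ forall v, 0 < w v, \sum_v w v = 1,
      forall I : pred V, indep e I -> \sum_(v | I v) w v <= delta &
      K%:R <= Num.sqrt (#|V|%:R / ln #|V|%:R : R)]].
Proof.
move=> d0.
have [k kd] : exists k : nat, delta^-1 ^+ 2 <= k%:R.
  by exists (Num.bound (delta^-1 ^+ 2)); rewrite ltW// archi_boundP// sqr_ge0.
have [V [e [w [f [es ei et eh [f1 fk _ [w0 wf wI]]]]]]] :=
  triangle_free_large_frac_clique R k.
have f0 : 0 < f by exact: lt_trans f1.
have fd : f^-1 <= delta.
  rewrite -[leRHS]invrK lef_pV2 ?posrE ?invr_gt0//.
  rewrite -ler_sqr ?nnegrE ?invr_ge0 ?(ltW d0) ?(ltW f0)//.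
  exact: le_trans kd fk.
have V0 : (0 < #|V|)%N.
  case: eh => A [_ [A3 _]].
  by rewrite (leq_trans _ (max_card (mem A)))// (leq_trans _ A3).
(* With [4 * K ^ 3] copies there are [n = t ^ 2] vertices for [t = 2 * K ^ 2]. Then
   [n / ln n = t ^ 2 / (2 * ln t)], which is at least [t / 2 = K ^ 2] because [ln t < t]. *)
pose K := #|V|; pose m := (4 * K ^ 3).-1.
have m1E : m.+1 = (4 * K ^ 3)%N by rewrite prednK// muln_gt0 expn_gt0 V0.
have m0 : 0 < m.+1%:R :> R by rewrite ltr0n.
exists (V * 'I_m.+1)%type, (@copies V e m), (fun x => w x.1 / f / m.+1%:R), K.
exists (fun x => enum_rank x.1); split.
- exact: copies_sym.
- exact: copies_triangle_free.
- exact: copies_odd_hole.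
- move=> i j /andP[_ eij]; rewrite (inj_eq enum_rank_inj).
  by apply: contraTN eij => /eqP ->; rewrite ei.
split.
- by move=> v; rewrite !divr_gt0.
- rewrite (copies_weight (fun v => w v / f) predT)/=.
  under eq_bigr => i _ do rewrite -mulr_suml wf mulfV ?gt_eqF//.
  by rewrite sumr_const card_ord mulfV// gt_eqF.
- move=> I Ii; rewrite (copies_weight (fun v => w v / f)) ler_pdivrMr//.
  rewrite mulr_natr -[in leRHS](card_ord m.+1) -sumr_const ler_sum// => i _.
  rewrite -mulr_suml (le_trans _ fd)// -[leRHS]mul1r ler_pM2r ?invr_gt0//.
  by apply: wI => x y Ix Iy; have := Ii _ _ Ix Iy; rewrite /copies eqxx.
have -> : #|{: V * 'I_m.+1}| = ((2 * K ^ 2) ^ 2)%N.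
  by rewrite card_prod card_ord m1E -/K; ring.
set t := (2 * K ^ 2)%N.
have K0 : 0 < K%:R :> R by rewrite ltr0n.
have t1 : 1 < t%:R :> R.
  by rewrite ltr1n; apply: leq_pmulr; rewrite expn_gt0 V0.
have t0 : 0 < t%:R :> R by apply: lt_trans t1.
have lnt : 0 < ln t%:R :> R by rewrite ln_gt0.
rewrite -[leLHS]ger0_norm ?ler0n// -sqrtr_sqr ler_wsqrtr// natrX lnXn//.
rewrite ler_pdivlMr; last by rewrite mulrn_wgt0.
have := ln_sublinear t0.
have tE : t%:R = 2 * K%:R ^+ 2 :> R by rewrite /t natrM natrX.
rewrite -[ln _ *+ 2]mulr_natr.
move=> /ltW lt.
rewrite [leRHS](_ : _ = K%:R ^+ 2 * (t%:R * 2)); last by rewrite tE; ring.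
by rewrite ler_pM2l ?exprn_gt0// ler_pM2r.
Qed.

(** * Graphs as intersection graphs of balls *)

Section BallsMeet.
Variables (R : realType) (d : nat).
Implicit Types (u v x : 'rV[R]_d) (eps r : R).

Definition balls_meet (p : \bar R) eps u v :=
  exists x, lpball p u eps x /\ lpball p v eps x.

Lemma powR_le_root (a eps r : R) : 0 < r -> 0 <= a -> 0 <= eps ->
  (a `^ r^-1 <= eps) = (a <= eps `^ r).
Proof.
move=> r0 a0 e0; apply/idP/idP => h.
  have /(ge0_ler_powR (ltW r0)) := h; rewrite !nnegrE powR_ge0 e0.
  by rewrite -powRrM mulVf ?gt_eqF// powRr1//; exact.
have rV0 : 0 <= r^-1 by rewrite invr_ge0 ltW.
have /(ge0_ler_powR rV0) := h; rewrite !nnegrE powR_ge0 a0.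
by rewrite -powRrM mulfV ?gt_eqF// powRr1//; exact.
Qed.

Lemma lpball_finE r eps u x : 0 < r -> 0 <= eps ->
  lpball r%:E u eps x <-> \sum_i `|x 0 i - u 0 i| `^ r <= eps `^ r.
Proof.
move=> r0 e0; rewrite /lpball/= powR_le_root//; last first.
  by apply: sumr_ge0 => i _; exact: powR_ge0.
by under eq_bigr do rewrite !mxE.
Qed.

Lemma lpball_pinftyE eps u x : 0 <= eps ->
  lpball +oo%E u eps x <-> forall i, `|x 0 i - u 0 i| <= eps.
Proof.
move=> e0; rewrite /lpball/=; split=> [/bigmax_leP[_ h] i|h].
  by have := h i isT; rewrite !mxE.
by apply/bigmax_leP; split=> // i _; rewrite !mxE.
Qed.

Lemma powR_midpoint_le r (a b : R) : 1 <= r -> 0 <= a -> 0 <= b ->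
  ((a + b) / 2) `^ r <= (a `^ r + b `^ r) / 2.
Proof.
move=> r1 a0 b0.
have h0 : 0 <= 2^-1 :> R by rewrite invr_ge0.
have h1 : 2^-1 <= 1 :> R by rewrite invf_le1 ?ler1n.
have E (x y : R) : (x + y) / 2 = 2^-1 * x + (1 - 2^-1) * y by field.
rewrite !E.
by apply: (convex_powR r1 (Itv01 h0 h1)); rewrite inE/= in_itv/= ?a0 ?b0.
Qed.

(** The midpoint of the centres is a common point if there is any. For the converse, convexity of
    the power function, applied coordinatewise, replaces Minkowski's inequality. *)
Lemma balls_meet_finE r eps u v : 1 <= r -> 0 <= eps ->
  balls_meet r%:E eps u v <->
  \sum_i `|u 0 i - v 0 i| `^ r <= (2 * eps) `^ r.
Proof.
move=> r1 e0; have r0 : 0 < r by apply: lt_le_trans r1.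
have p2 : 0 < (2 : R) `^ r by rewrite powR_gt0.
have nnV2 : 0 <= 2^-1 :> R by rewrite invr_ge0.
have V2E : (2^-1 : R) `^ r = (2 `^ r)^-1.
  by apply: (mulfI (lt0r_neq0 p2)); rewrite -powRM// !mulfV ?powR1// gt_eqF.
split.
  move=> [x [/lpball_finE ux /lpball_finE vx]].
  have {}ux := ux r0 e0; have {}vx := vx r0 e0.
  have : \sum_i (`|u 0 i - v 0 i| / 2) `^ r
      <= (\sum_i `|x 0 i - u 0 i| `^ r + \sum_i `|x 0 i - v 0 i| `^ r) / 2.
    rewrite -big_split/= mulr_suml; apply: ler_sum => i _.
    apply: le_trans (powR_midpoint_le r1 _ _) => //.
    rewrite ge0_ler_powR ?nnegrE ?divr_ge0 ?addr_ge0 ?(ltW r0)//.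
    rewrite ler_pM2r ?invr_gt0//.
    rewrite (_ : u 0 i - v 0 i = (x 0 i - v 0 i) - (x 0 i - u 0 i)); last by ring.
    by rewrite (le_trans (ler_normB _ _))// addrC.
  under eq_bigr do rewrite powRM// V2E.
  rewrite -mulr_suml ler_pdivrMr// powRM// => /le_trans; apply.
  by rewrite mulrC ler_pM2l//; lra.
move=> uv; exists (2^-1 *: (u + v)).
have half (w : 'rV[R]_d) :
    (forall i, `|(2^-1 *: (u + v)) 0 i - w 0 i| = `|u 0 i - v 0 i| / 2) ->
    lpball r%:E w eps (2^-1 *: (u + v)).
  move=> E; apply/lpball_finE => //.
  under eq_bigr do rewrite E powRM// V2E.
  by rewrite -mulr_suml ler_pdivrMr// mulrC -powRM.
have nE (a b : R) : a = b / 2 \/ a = - (b / 2) -> `|a| = `|b| / 2.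
  by move=> [] ->; rewrite ?normrN normrM (ger0_norm nnV2).
split; apply: half => i; rewrite !mxE; apply: nE; [right|left]; by field.
Qed.

Lemma balls_meet_pinftyE eps u v : 0 <= eps ->
  balls_meet +oo%E eps u v <-> forall i, `|u 0 i - v 0 i| <= 2 * eps.
Proof.
move=> e0; split.
  move=> [x [/lpball_pinftyE ux /lpball_pinftyE vx]] i.
  have {}ux := ux e0 i; have {}vx := vx e0 i.
  rewrite (_ : u 0 i - v 0 i = (x 0 i - v 0 i) - (x 0 i - u 0 i)); last by ring.
  by rewrite (le_trans (ler_normB _ _))//; lra.
move=> uv; exists (2^-1 *: (u + v)); split; apply/lpball_pinftyE => // i;
  have := uv i; rewrite !mxE !ler_norml => /andP[? ?]; lra.
Qed.

End BallsMeet.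

(** * Coordinates realizing a prescribed graph *)

Section Realization.
Variables (R : realType) (V : finType) (e : rel V).
Hypothesis e_sym : symmetric e.

(* Non-adjacent vertices [i] and [j] have opposite signs at the coordinates
   [(i, j, true)] and [(j, i, true)]; at every other coordinate, and for
   adjacent vertices at every coordinate, at most one of the two is nonzero.
   The coordinates [(_, _, false)] give all vertices the same number of nonzero
   entries. *)
Definition graph_coord (i : V) (c : V * V * bool) : R :=
  let: (k, l, b) := c in
  if b then (i == k)%:R - (compl_graph e k l && (i == l))%:R
  else (~~ compl_graph e k l && (i == l))%:R.

Definition diff_ind (i j k : V) : R := (i == k)%:R - (j == k)%:R.

Lemma graph_coordB i j k l b :
  graph_coord i (k, l, b) - graph_coord j (k, l, b) =
  if compl_graph e k l then if b then diff_ind i j k - diff_ind i j l else 0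
  else if b then diff_ind i j k else diff_ind i j l.
Proof.
rewrite /graph_coord/= /diff_ind; case: (compl_graph e k l); case: b => /=; ring.
Qed.

Lemma diff_ind_neq0 i j k : diff_ind i j k != 0 -> k = i \/ k = j.
Proof.
rewrite /diff_ind.
case: (i =P k) => [->|_]; first by left.
by case: (j =P k) => [->|_]; [right|rewrite subrr eqxx].
Qed.

Lemma diff_ind_l i j : i != j -> diff_ind i j i = 1.
Proof. by rewrite /diff_ind eqxx eq_sym => /negPf ->; rewrite subr0. Qed.

Lemma diff_ind_r i j : i != j -> diff_ind i j j = -1.
Proof. by rewrite /diff_ind eqxx => /negPf ->; rewrite sub0r. Qed.

Lemma norm_diff_ind_le1 i j k : `|diff_ind i j k| <= 1.
Proof.
rewrite /diff_ind; case: eqP; case: eqP; rewrite ?subrr ?subr0 ?sub0r ?normrN;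
  by rewrite ?normr0 ?normr1.
Qed.

(** For [k] and [l] distinct, both differences are nonzero only if [k, l] are [i, j] in some order;
    this is where the two signs can reinforce each other. *)
Variant diff_ind_spec i j k l : Prop :=
  | DiffInd0l of diff_ind i j k = 0
  | DiffInd0r of diff_ind i j l = 0
  | DiffIndLR of k = i & l = j
  | DiffIndRL of k = j & l = i.

Lemma diff_indP i j k l : compl_graph e k l -> diff_ind_spec i j k l.
Proof.
move=> /andP[kl _].
have [h|/diff_ind_neq0 hk] := eqVneq (diff_ind i j k) 0; first by constructor 1.
have [h|/diff_ind_neq0 hl] := eqVneq (diff_ind i j l) 0; first by constructor 2.
case: hk hl kl => -> [] ->; rewrite ?eqxx// => _; by [constructor 3|constructor 4].
Qed.

Lemma compl_graph_diff_ind i j k l : e i j -> compl_graph e k l ->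
  diff_ind i j k = 0 \/ diff_ind i j l = 0.
Proof.
move=> eij kl; case: (diff_indP i j kl) => [||ki lj|kj li]; [by left|by right| |];
  by move: kl; rewrite /compl_graph ?ki ?lj ?kj ?li ?(e_sym j i) eij andbF.
Qed.

Section PowerSum.
Variable r : R.
Hypothesis r1 : 1 < r.

Let r0 : 0 < r. Proof. exact: lt_trans r1. Qed.
Let powR0r : 0 `^ r = 0 :> R. Proof. by rewrite powR0 ?gt_eqF. Qed.

Definition pair_power i j k l : R :=
  \sum_b `|graph_coord i (k, l, b) - graph_coord j (k, l, b)| `^ r.

Lemma pair_powerE i j k l : pair_power i j k l =
  if compl_graph e k l then `|diff_ind i j k - diff_ind i j l| `^ r
  else `|diff_ind i j k| `^ r + `|diff_ind i j l| `^ r.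
Proof.
rewrite /pair_power big_bool !graph_coordB.
by case: (compl_graph e k l) => /=; rewrite ?normr0 ?powR0r ?addr0.
Qed.

Lemma sum_diff_ind i j : i != j -> \sum_k `|diff_ind i j k| `^ r = 2.
Proof.
move=> ij; rewrite (bigD1 i)//= (bigD1 j) 1?eq_sym//= diff_ind_l// diff_ind_r//.
rewrite normrN1 normr1 powR1 big1 ?addr0// => k /andP[ki kj].
have [->|/diff_ind_neq0[]] := eqVneq (diff_ind i j k) 0.
- by rewrite normr0.
- by move/eqP; rewrite (negPf ki).
- by move/eqP; rewrite (negPf kj).
Qed.

(** This value, the same for all pairs [i != j], is the threshold separating adjacent from
    non-adjacent pairs. *)
Lemma sum_pair_diff_ind i j : i != j ->
  \sum_k \sum_l (`|diff_ind i j k| `^ r + `|diff_ind i j l| `^ r) =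
  4 * #|V|%:R.
Proof.
move=> ij; under eq_bigr do rewrite big_split/= sum_diff_ind// sumr_const.
rewrite big_split/= sumr_const sumrMnl sum_diff_ind//.
by rewrite -mulrnDl -[LHS]mulr_natr -natrD.
Qed.

Lemma two_lt_powR : 2 < (2 : R) `^ r.
Proof.
by rewrite -[ltLHS](@powRr1 _ 2)// /powR gt_eqF// ltr_expR ltr_pM2r// ln_gt0// ltr1n.
Qed.

Lemma pair_power_adj i j k l : e i j ->
  pair_power i j k l = `|diff_ind i j k| `^ r + `|diff_ind i j l| `^ r.
Proof.
move=> eij; rewrite pair_powerE; case: ifP => // kl.
case: (compl_graph_diff_ind eij kl) => ->.
  by rewrite sub0r normrN normr0 powR0r add0r.
by rewrite subr0 normr0 powR0r addr0.
Qed.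

Lemma pair_power_ge i j k l : i != j ->
  `|diff_ind i j k| `^ r + `|diff_ind i j l| `^ r <= pair_power i j k l.
Proof.
move=> ij; rewrite pair_powerE; case: ifP => // kl.
case: (diff_indP i j kl) => [->|->|-> ->|-> ->].
- by rewrite sub0r normrN normr0 powR0r add0r.
- by rewrite subr0 normr0 powR0r addr0.
- rewrite diff_ind_l// diff_ind_r// opprK normrN1 normr1 powR1.
  by rewrite [ `|_|]ger0_norm ?ler0n// ltW// two_lt_powR.
- rewrite diff_ind_l// diff_ind_r// -opprD !normrN normr1 powR1.
  by rewrite [ `|_|]ger0_norm ?ler0n// ltW// two_lt_powR.
Qed.

Lemma pair_power_nonadj i j : i != j -> ~~ e i j ->
  `|diff_ind i j i| `^ r + `|diff_ind i j j| `^ r < pair_power i j i j.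
Proof.
move=> ij eij; rewrite pair_powerE /compl_graph ij eij/=.
rewrite diff_ind_l// diff_ind_r// opprK normrN1 normr1 powR1.
by rewrite [ `|_|]ger0_norm ?ler0n// two_lt_powR.
Qed.

Lemma sum_graph_coordB i j :
  \sum_c `|graph_coord i c - graph_coord j c| `^ r =
  \sum_k \sum_l pair_power i j k l.
Proof. by rewrite pair_big/= pair_big/=; apply: eq_bigr => -[[k l] b]. Qed.

(** Adjacent vertices reach the threshold exactly; for non-adjacent ones no block falls below its
    share and the block [(i, j)] exceeds it. *)
Lemma graph_coord_fin i j : i != j ->
  e i j = (\sum_c `|graph_coord i c - graph_coord j c| `^ r <= 4 * #|V|%:R).
Proof.
move=> ij; rewrite sum_graph_coordB -(sum_pair_diff_ind ij).
rewrite pair_bigA [X in _ <= X]pair_bigA/=.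
case: (boolP (e i j)) => eij; apply/esym.
  by apply/idP; apply: ler_sum => -[k l] _; rewrite pair_power_adj.
apply/negbTE; rewrite -ltNge (bigD1 (i, j))//= [ltRHS](bigD1 (i, j))//=.
apply: ltr_leD; first exact: pair_power_nonadj.
by apply: ler_sum => -[k l] _; exact: pair_power_ge.
Qed.

End PowerSum.

Lemma graph_coord_pinfty i j : i != j ->
  e i j <-> forall c, `|graph_coord i c - graph_coord j c| <= 1.
Proof.
move=> ij; split=> [eij [[k l] b]|h].
  rewrite graph_coordB; case: ifP => kl; case: b;
    rewrite ?normr0 ?norm_diff_ind_le1//.
  by case: (compl_graph_diff_ind eij kl) => ->;
    rewrite ?sub0r ?subr0 ?normrN norm_diff_ind_le1.
apply: contraT => eij; have := h (i, j, true).
rewrite graph_coordB /compl_graph ij eij/= diff_ind_l// diff_ind_r// opprK.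
by rewrite ger0_norm ?addr_ge0// gerDl ler10.
Qed.

Definition graph_point (a : R) (i : V) : 'rV[R]_#|{: V * V * bool}| :=
  \row_j (a * graph_coord i (enum_val j)).

Lemma graph_pointB a i j k : graph_point a i 0 k - graph_point a j 0 k =
  a * (graph_coord i (enum_val k) - graph_coord j (enum_val k)).
Proof. by rewrite !mxE mulrBr. Qed.

Lemma sum_graph_pointB a r i j : 0 < a ->
  \sum_k `|graph_point a i 0 k - graph_point a j 0 k| `^ r =
  a `^ r * \sum_c `|graph_coord i c - graph_coord j c| `^ r.
Proof.
move=> a0; rewrite mulr_sumr [RHS](reindex _ (onW_bij _ (@enum_val_bij _))).
by apply: eq_bigr => k _; rewrite graph_pointB normrM gtr0_norm// powRM// ltW.
Qed.

Lemma graph_realization (p : \bar R) (eps : R) : (1 < p)%E -> 0 < eps ->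
  exists d (x : V -> 'rV[R]_d), forall i j, i != j ->
    e i j <-> balls_meet p eps (x i) (x j).
Proof.
move=> p1 e0; exists #|{: V * V * bool}|.
have e2 : 0 < 2 * eps by rewrite mulr_gt0.
case: p p1 => [r||//].
- rewrite lte_fin => r1; have r0 : 0 < r by apply: lt_trans r1.
  exists (graph_point (2 * eps / (4 * #|V|%:R) `^ r^-1)) => i j ij.
  have V0 : 0 < 4 * #|V|%:R :> R.
    by rewrite mulr_gt0// ltr0n; apply/card_gt0P; exists i.
  have a0 : 0 < (4 * #|V|%:R) `^ r^-1 :> R by rewrite powR_gt0.
  have A0 : 0 < (2 * eps / (4 * #|V|%:R) `^ r^-1) `^ r.
    by rewrite powR_gt0// divr_gt0.
  have aE : (2 * eps) `^ r
      = (2 * eps / (4 * #|V|%:R) `^ r^-1) `^ r * (4 * #|V|%:R).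
    have V0E : 4 * #|V|%:R = ((4 * #|V|%:R) `^ r^-1) `^ r :> R.
      by rewrite -powRrM mulVf ?powRr1 ?lt0r_neq0// ltW.
    rewrite [in X in _ = _ * X]V0E -powRM ?(ltW a0) ?(ltW (divr_gt0 e2 a0))//.
    by rewrite divfK// lt0r_neq0.
  rewrite (graph_coord_fin r1 ij).
  apply: iff_trans (iff_sym (balls_meet_finE _ _ (ltW r1) (ltW e0))).
  by rewrite sum_graph_pointB ?divr_gt0// aE ler_pM2l.
- move=> _; exists (graph_point (2 * eps)) => i j ij.
  apply: iff_trans (iff_sym (balls_meet_pinftyE _ _ (ltW e0))).
  apply: iff_trans (graph_coord_pinfty ij) _; split=> h k.
    by rewrite graph_pointB normrM gtr0_norm// ler_piMr// ltW.
  have := h (enum_rank k); rewrite graph_pointB enum_rankK normrM gtr0_norm//.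
  by rewrite ger_pMr.
Qed.

End Realization.

(** * Optimal risks *)

(** Weights are added along the fibres of [phi], so expectations become sums over [V] even if [phi]
    is not injective. It serves for [mu] and for the predicted label distributions. *)
Lemma fsdist_pushforward (R : realType) (V : finType) (T : choiceType)
    (phi : V -> T) (w : V -> R) :
  (forall v, 0 <= w v) -> \sum_v w v = 1 ->
  exists mu : fsdist R T,
    (forall z, z \in finsupp mu <-> exists2 v, phi v = z & 0 < w v) /\
    (forall F, Esp mu F = \sum_v w v * F (phi v)).
Proof.
move=> w0 w1.
pose g z := \sum_(v | phi v == z) w v.
pose S := [fset phi v | v in V]%fset.
pose mu := [fsfun z in S => g z | 0] : {fsfun T -> R with 0}.
have phiS v : phi v \in S by apply/imfsetP; exists v.
have muE z : mu z = g z.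
  rewrite fsfun_fun; case: ifP => // zS; rewrite /g big_pred0// => v.
  by apply: contraFF zS => /eqP <-.
have mu_ge0 z : 0 <= mu z by rewrite muE; apply: sumr_ge0.
have suppS : (finsupp mu `<=` S)%fset.
  apply/fsubsetP => z; rewrite mem_finsupp muE; apply: contra_neqT => zS.
  rewrite /g big_pred0// => v; apply: contraNF zS => /eqP <-//.
have sumE F : \sum_(z <- finsupp mu) mu z * F z = \sum_v w v * F (phi v).
  rewrite (big_fset_incl _ suppS) => [|z _]; last first.
    by rewrite mem_finsupp negbK => /eqP ->; rewrite mul0r.
  have muF z : mu z * F z = \sum_(v | phi v == z) w v * F (phi v).
    by rewrite muE mulr_suml; apply: eq_bigr => v /eqP ->.
  under eq_bigr do rewrite muF.
  rewrite (exchange_big_dep predT)//=; apply: eq_bigr => v _.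
  rewrite -big_filter (_ : [seq z <- S | phi v == z] = [:: phi v]) ?big_seq1//.
  rewrite -(@filter_pred1_uniq _ (enum_fset S)) ?fset_uniq//.
  by apply: eq_filter => z; rewrite eq_sym.
have sum1 : \sum_(z <- finsupp mu) mu z = 1.
  by have := sumE (fun=> 1); under eq_bigr do rewrite mulr1; move=> ->;
     under eq_bigr do rewrite mulr1.
exists (FSDist mu_ge0 sum1); split=> [z|F]; last exact: sumE.
rewrite mem_finsupp /= muE; split.
  move=> /eqP/psumr_neq0P[//|v /andP[/eqP <- wv]]; by exists v.
move=> [v <- wv]; rewrite gt_eqF// /g (bigD1 v)//= ltr_pwDl//.
exact: sumr_ge0.
Qed.

Section Risk.
Variables (R : realType) (d K : nat) (p : \bar R) (eps : R).
Variables (V : finType) (e : rel V) (w : V -> R).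
Variables (x : V -> 'rV[R]_d) (y : V -> 'I_K).
Variable mu : fsdist R ('rV[R]_d * 'I_K)%type.
Hypotheses (p1 : (1 < p)%E) (eps0 : 0 < eps).
Hypotheses (e_sym : symmetric e) (etf : triangle_free e).
Hypothesis exy : forall i j, i != j -> e i j <-> balls_meet p eps (x i) (x j).
Hypothesis ey : forall i j, e i j -> y i != y j.
Hypotheses (w_gt0 : forall v, 0 < w v) (w1 : \sum_v w v = 1).
Hypothesis supp_mu :
  forall z, z \in finsupp mu <-> exists2 v, (x v, y v) = z & 0 < w v.
Hypothesis Esp_mu : forall F, Esp mu F = \sum_v w v * F (x v, y v).

Lemma lpball_center (u : 'rV[R]_d) : lpball p u eps u.
Proof.
case: p p1 => [r||//].
  rewrite lte_fin => r1; have r0 : 0 < r by apply: lt_trans r1.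
  apply/lpball_finE; rewrite ?(ltW eps0)// big1 ?powR_ge0// => i _.
  by rewrite subrr normr0 powR0// gt_eqF.
move=> _; apply/lpball_pinftyE; first exact: ltW.
by move=> i; rewrite subrr normr0 ltW.
Qed.

Lemma point_exists : exists v : V, True.
Proof.
have /psumr_neq0P[|v _] : \sum_v w v <> 0 by rewrite w1; apply/eqP/oner_neq0.
  by move=> v _; exact: ltW.
by exists v.
Qed.

(** The bound by 1 keeps [sup] from taking its default value. *)
Lemma le_sup_lpball (F : 'rV[R]_d -> R) (u x' : 'rV[R]_d) :
  (forall x', F x' <= 1) -> lpball p u eps x' ->
  F x' <= sup [set F x' | x' in lpball p u eps]%classic.
Proof.
move=> F1 ux'; apply: ub_le_sup; last by exists x'.
by exists 1 => _ [x'' _ <-].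
Qed.

(** Adjacent vertices share a point of their balls but not their label, so [f] cannot be robustly
    correct at both. Every vertex outside the independent set [I] loses its full weight. *)
Lemma opt_risk_det_ge (delta : R) :
  (forall I : pred V, indep e I -> \sum_(v | I v) w v <= delta) ->
  1 - delta <= opt_risk_det p mu eps.
Proof.
move=> Idelta; have [v0 _] := point_exists.
apply: lb_le_inf; first by exists (risk_det p mu eps (fun=> y v0)), (fun=> y v0).
move=> _ [f _ <-]; rewrite /risk_det Esp_mu/=.
pose I v := `[< forall x', lpball p (x v) eps x' -> f x' = y v >].
have /Idelta Id : indep e I.
  move=> i j /asboolP Ii /asboolP Ij; apply/negP => eij.
  have ij : i != j by apply: contra_neq (ey eij) => ->.
  have [x' [xi xj]] := (exy ij).1 eij.
  by have := ey eij; rewrite -(Ii _ xi) -(Ij _ xj) eqxx.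
rewrite lerBlDr; apply: (le_trans _ (lerD (lexx _) Id)).
rewrite -[leLHS]w1.
rewrite [\sum_(v | I v) _]big_mkcond -big_split/=; apply: ler_sum => v _.
have w0 := ltW (w_gt0 v).
have b1 x' : (f x' != y v)%:R <= 1 :> R by rewrite lern1 leq_b1.
case: ifPn => [_|/asboolPn/existsNP[x' /not_implyP[vx' /eqP fx']]].
  rewrite lerDr mulr_ge0// (le_trans _ (le_sup_lpball b1 (lpball_center (x v))))//.
rewrite addr0 ler_peMr// (le_trans _ (le_sup_lpball b1 vx'))//.
by rewrite (negbTE fx').
Qed.

(* Three points of distinct labels whose balls share a point would form a
   triangle, so at most two labels compete at any given point. *)
Lemma local_classifier (x' : 'rV[R]_d) :
  exists nu : fsdist R 'I_K, forall v, lpball p (x v) eps x' ->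
    Esp nu (fun z => (z != y v)%:R) <= 1 / 2.
Proof.
have [v0 _] := point_exists.
pose L0 : {pred 'I_K} :=
  [pred z | `[< exists2 v, y v = z & lpball p (x v) eps x' >]].
have L0_le2 : (#|L0| <= 2)%N.
  rewrite leqNgt; apply/negP => /card_gt2P[z1 [z2 [z3 []]]].
  case=> /asboolP[i1 <- h1] /asboolP[i2 <- h2] /asboolP[i3 <- h3] [n12 n23 n31].
  have meet i j : y i != y j -> lpball p (x i) eps x' ->
      lpball p (x j) eps x' -> e i j.
    move=> yij hi hj; have ij : i != j by apply: contra_neq yij => ->.
    by apply/(exy ij).2; exists x'.
  have := etf (meet _ _ n12 h1 h2) (meet _ _ n23 h2 h3).
  by rewrite e_sym (meet _ _ n31 h3 h1).
(* If no ball contains [x'], an arbitrary label is used, so that the uniform distribution on [L]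
   exists. *)
have [L [L0L L_gt0 L_le2]] : exists L : {pred 'I_K},
    [/\ {subset L0 <= L}, (0 < #|L|)%N & (#|L| <= 2)%N].
  have [L00|L0n] := eqVneq #|L0| 0%N; last by exists L0; split; rewrite ?lt0n.
  exists (pred1 (y v0) : {pred 'I_K}); rewrite card1; split=> // z.
  by rewrite (card0_eq L00).
have cL : 0 < #|L|%:R :> R by rewrite ltr0n.
pose u z : R := (z \in L)%:R / #|L|%:R.
have u0 z : 0 <= u z by rewrite divr_ge0.
have u1 : \sum_z u z = 1.
  rewrite -mulr_suml -[X in X / _](_ : #|L|%:R = _) ?mulfV ?gt_eqF//.
  by rewrite -sum1_card natr_sum big_mkcond; apply: eq_bigr => z _; case: ifP.
have [nu [_ nuE]] := fsdist_pushforward id u0 u1.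
exists nu => v hv; rewrite nuE (bigD1 (y v))//= eqxx mulr0 add0r.
under eq_bigr => z zv do rewrite zv mulr1.
have yL : y v \in L by apply: L0L; apply/asboolP; exists v.
have : 2^-1 <= u (y v).
  by rewrite /u yL div1r lef_pV2 ?posrE// ler_nat.
by move: u1; rewrite (bigD1 (y v))//= => u1 u_ge; lra.
Qed.

Lemma opt_risk_rand_le : opt_risk_rand p mu eps <= 1 / 2.
Proof.
have [f fP] := choice local_classifier.
apply: (@le_trans _ _ (risk_rand p mu eps f)).
  apply: ge_inf; last by exists f.
  (* All risks are nonnegative, so the infimum is a genuine one. *)
  exists 0 => _ [g _ <-]; rewrite /risk_rand Esp_mu/=.
  apply: sumr_ge0 => v _; apply: mulr_ge0; first exact: ltW.
  have Esp_ge0 x' : 0 <= Esp (g x') (fun z => (z != y v)%:R).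
    by apply: sumr_ge0 => z _; rewrite mulr_ge0// fsdist_ge0.
  apply: le_trans (Esp_ge0 (x v)) _; apply: le_sup_lpball (lpball_center _).
  move=> x'; rewrite -[leRHS](fsdist_sum1 (g x')); apply: ler_sum => z _.
  by apply: ler_piMr; rewrite ?fsdist_ge0 ?lern1 ?leq_b1.
rewrite (_ : 1 / 2 = \sum_v w v * (1 / 2)); last by rewrite -mulr_suml w1 [RHS]mul1r.
rewrite /risk_rand Esp_mu/=; apply: ler_sum => v _.
rewrite ler_pM2l//; apply: ge_sup.
  exists (Esp (f (x v)) (fun z => (z != y v)%:R)), (x v) => //.
  exact: lpball_center.
by move=> _ [x' hx' <-]; exact: fP.
Qed.

(** * The conflict graph and hypergraph of the support *)

Let G := conflict_graph p eps (support_tuple mu).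
Let H := conflict_hypergraph p eps (support_tuple mu).
Let s := support_tuple mu.

Lemma conflict_hypergraphP (A : {set 'I_#|` finsupp mu|}) :
  A \in H <-> [/\ A != finset.set0,
    forall i j, i \in A -> j \in A -> i != j -> (tnth s i).2 != (tnth s j).2 &
    exists x', forall i, i \in A -> lpball p (tnth s i).1 eps x'].
Proof.
rewrite finset.in_set; split.
  move=> /and3P[A0 /forall_inP Al /asboolP[x' Ax']]; split=> //.
    by move=> i j iA jA; exact: (implyP (forall_inP (Al i iA) j jA)).
  by exists x' => i iA; exact: Ax'.
move=> [A0 Al [x' Ax']]; apply/and3P; split=> //.
  by apply/forall_inP => i iA; apply/forall_inP => j jA; apply/implyP; exact: Al.
by apply/asboolP; exists x' => i iA; exact: Ax'.
Qed.

(** Distinct vertices give distinct labelled points: if their centres coincide, their balls meet, so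
    they are adjacent and their labels differ. *)
Lemma support_bij :
  exists (g : 'I_#|` finsupp mu| -> V) (h : V -> 'I_#|` finsupp mu|),
  [/\ cancel g h, cancel h g & forall i, tnth s i = (x (g i), y (g i))].
Proof.
have phi_inj i j : (x i, y i) = (x j, y j) -> i = j.
  move=> [xij yij]; apply/eqP; apply: contraPT yij => ij; apply/eqP; apply: ey.
  apply/(exy ij).2; exists (x i); rewrite -xij; split; exact: lpball_center.
have tnth_inj : injective (tnth s) by apply/tuple_uniqP; exact: fset_uniq.
have [g gP] : {g & forall i, tnth s i = (x (g i), y (g i))}.
  apply: (@choice _ _ (fun i v => tnth s i = (x v, y v))) => i.
  have /supp_mu[v <- _] : tnth s i \in finsupp mu.
    exact: mem_tnth.
  by exists v.
have [h hP] : {h & forall v, tnth s (h v) = (x v, y v)}.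
  apply: (@choice _ _ (fun v i => tnth s i = (x v, y v))) => v.
  have /tnthP[i ->] : (x v, y v) \in s by apply/supp_mu; exists v.
  by exists i.
exists g, h; split=> // [i|v].
  by apply: tnth_inj; rewrite hP gP.
by apply: phi_inj; rewrite -gP hP.
Qed.

Lemma card_support : #|` finsupp mu| = #|V|.
Proof.
have [g [h [gh hg _]]] := support_bij.
by rewrite -[LHS]card_ord; apply: (@bij_eq_card _ _ g); exists h.
Qed.

Section ConflictGraph.
Variable g : 'I_#|` finsupp mu| -> V.
Hypotheses (g_inj : injective g).
Hypothesis gs : forall i, tnth s i = (x (g i), y (g i)).

Lemma conflict_graphE i j : i != j -> G i j = e (g i) (g j).
Proof.
move=> ij; rewrite /G /conflict_graph cards2 ij andbT.
have gij : g i != g j by rewrite (inj_eq g_inj).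
apply/idP/idP.
  move=> /conflict_hypergraphP[_ _ [x' hx']]; apply/(exy gij).2; exists x'.
  by split; [have := hx' i|have := hx' j]; rewrite gs; apply;
    rewrite !finset.inE eqxx ?orbT.
move=> eij; have [x' [hi hj]] := (exy gij).1 eij.
apply/conflict_hypergraphP; split.
- by apply/set0Pn; exists i; rewrite !finset.inE eqxx.
- move=> k l; rewrite !finset.inE => /orP[]/eqP -> /orP[]/eqP ->;
    rewrite ?eqxx// !gs => _.
    exact: ey.
  by rewrite eq_sym; exact: ey.
- by exists x' => k; rewrite !finset.inE => /orP[]/eqP ->; rewrite gs.
Qed.

(** Without triangles a clique has at most two vertices. A pair is a hyperedge by definition of the
    graph, and a singleton is one because a ball contains its centre. *)
Lemma conflict_conformal : conformal H G.
Proof.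
move=> A [/set0Pn[i iA] cA].
have [[j [jA ij]]|Ai] := pselect (exists j, j \in A /\ i != j).
  suff -> : A = [set i; j]%SET by have /andP[] := cA i j iA jA ij.
  apply/setP => k; rewrite !finset.inE; apply/idP/idP => [kA|/orP[]/eqP -> //].
  apply: contraT; rewrite negb_or => /andP[ki kj].
  have := etf (_ : e (g i) (g j)) (_ : e (g j) (g k)).
  have jk : j != k by rewrite eq_sym.
  have ik : i != k by rewrite eq_sym.
  by rewrite -!conflict_graphE// !cA//; apply.
apply/conflict_hypergraphP; split.
- by apply/set0Pn; exists i.
- move=> k l kA lA kl; case: Ai; have [ik|ik] := eqVneq i k; last by exists k.
  by exists l; rewrite ik.
- exists (x (g i)) => k kA; have [->|ik] := eqVneq k i.
    by rewrite gs; exact: lpball_center.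
  by case: Ai; exists k; rewrite eq_sym.
Qed.

End ConflictGraph.

Lemma conflict_not_perfect : irreflexive e -> has_odd_hole e -> ~ perfect G.
Proof.
move=> e_irr ehole [noh _]; apply: noh.
have [g [h [gh hg gs]]] := support_bij.
apply: (has_odd_hole_embed (can_inj hg) _ ehole) => a b.
(* [conflict_graphE] covers distinct vertices only; on the diagonal both relations are false. *)
have [->|ab] := eqVneq a b.
  by rewrite e_irr /G /conflict_graph finset.setUid cards1 andbF.
by rewrite (conflict_graphE (can_inj gh) gs) ?(inj_eq (can_inj hg))// !hg.
Qed.

End Risk.

Theorem theorem5p1 (R : realType) :
  exists C : R, 0 < C /\
  forall (eps : R) (p : \bar R) (delta : R),
    0 < eps -> (1 < p)%E -> 0 < delta ->
  exists (d K : nat) (mu : fsdist R ('rV[R]_d * 'I_K)%type),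
    let n := #|` finsupp mu| in
    let H := conflict_hypergraph p eps (support_tuple mu) in
    let G := conflict_graph p eps (support_tuple mu) in
    [/\ 1 / 2 - delta <= rg p mu eps,
        ~ perfect G,
        conformal H G &
        K%:R <= C * Num.sqrt (n%:R / ln n%:R)].
Proof.
(* The number of copies was chosen large enough for the constant 1. *)
exists 1; split=> // eps p delta eps0 p1 delta0.
have [V [e [w [K [y [e_sym etf eh ey [w0 w1 wI Kn]]]]]]] :=
  sparse_colored_graph delta0.
have e_irr : irreflexive e.
  by move=> v; apply/negbTE/negP => /ey; rewrite eqxx.
have [d [x exy]] := graph_realization e_sym p1 eps0.
have [mu [supp_mu Esp_mu]] :=
  fsdist_pushforward (fun v => (x v, y v)) (fun v => ltW (w0 v)) w1.
exists d, K, mu => n H G; split.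
- have rdet := opt_risk_det_ge p1 eps0 exy ey w0 w1 Esp_mu wI.
  have rrand := opt_risk_rand_le p1 eps0 e_sym etf exy w0 w1 Esp_mu.
  by rewrite /rg; lra.
- exact: (conflict_not_perfect p1 eps0 exy ey w0 supp_mu e_irr eh).
- have [g [h [gh _ gs]]] := support_bij p1 eps0 exy ey w0 supp_mu.
  exact: (conflict_conformal p1 eps0 etf exy ey (can_inj gh) gs).
- by rewrite mul1r /n (card_support p1 eps0 exy ey w0 supp_mu).
Qed.
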